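(* Suppose that $D$ is a bounded strictly convex domain of a Banach space and $(D,d)$ is a $(1,\kappa)$-quasi-geodesic metric space (for some $\kappa\ge0$), whose topology coincides with the norm topology, satisfying Axiom $1'$ and the condition $$d(sx+(1-s)y,z)\le\max\{d(x,z),d(y,z)\}\quad\text{for all }x,y,z\in D,\ s\in[0,1].$$ If $S=\{f_t:D\to D\}_{t\ge0}$ is a one-parameter continuous semigroup of nonexpansive mappings on $(D,d)$, and there exists $t_0>0$ such that the mapping $f_{t_0}:D\to D$ is compact with $\mathrm{Fix}(f_{t_0})=\emptyset$, then there exists $\xi\in\partial D$ such that the semigroup $S$ converges uniformly on bounded sets of $D$ to $\xi$, i.e. $\sup_{x\in C}\|f_t(x)-\xi\|\to0$ as $t\to\infty$ for every $d$-bounded set $C\subset D$.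
   Context: $\overline{D}$ is the closure of $D$ in the norm topology and $\partial D=\overline{D}\setminus D$. $D$ is strictly convex if for any distinct $z,w\in\overline{D}$ the open segment $\{sz+(1-s)w:s\in(0,1)\}$ lies in $D$. $(D,d)$ is $(1,\kappa)$-quasi-geodesic if every pair of points of $D$ can be connected by a curve $\gamma:[a,b]\to D$ with $|t_1-t_2|-\kappa\le d(\gamma(t_1),\gamma(t_2))\le|t_1-t_2|+\kappa$ for all $t_1,t_2\in[a,b]$. Axiom $1'$ (here with ambient space $(\overline{D},\|\cdot\|)$): the topology of $d$ on $D$ coincides with the norm topology, and for any $w\in D$, if $\{x_n\}\subset D$ converges in norm to a point of $\partial D$, then $d(x_n,w)\to\infty$. A map $f:D\to D$ is nonexpansive if $d(f(x),f(y))\le d(x,y)$ for all $x,y\in D$; it is compact if the norm closure of $f(D)$ is compact in $\overline{D}$. $\mathrm{Fix}(f)=\{x\in D:f(x)=x\}$. A family $S=\{f_t:D\to D\}_{t\ge0}$ is a one-parameter continuous semigroup if $f_{s+t}=f_t\circ f_s$ for all $s,t\ge0$ and $\lim_{t\to0^+}f_t(y)=f_0(y)=y$ for every $y\in D$. *)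

(* Defs.v *)
From HB Require Import structures.
From mathcomp Require Import all_boot all_order all_algebra.
From mathcomp Require Import all_classical all_reals all_analysis.

Set Implicit Arguments.
Unset Strict Implicit.
Unset Printing Implicit Defensive.

Import Order.TTheory GRing.Theory Num.Theory.
Import numFieldNormedType.Exports.

Local Open Scope classical_set_scope.
Local Open Scope ring_scope.

(* [D] is a subset of a normed space [V]; the metric [d] and the self-maps of
   [D] are total functions on [V] of which only the values on [D] are ever
   used.  [open], [closure], [compact], [-->] refer to the norm topology. *)

Section Domains.
Context {R : realType} {V : normedModType R}.
Implicit Types D : set V.

(* Nonemptiness matters: on the empty set every map is vacuously compact and
   fixed point free. *)
Definition domain D : Prop := [/\ D !=set0, open D & connected D].

(* Not the topological boundary in general, but equal to it for open [D]. *)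
Definition bdry D : set V := closure D `\` D.

Definition strictly_convex D : Prop :=
  forall z w : V, closure D z -> closure D w -> z <> w ->
  forall s : R, 0 < s < 1 -> D (s *: z + (1 - s) *: w).

End Domains.

Section MetricsOnASubset.
Context {R : realType} {V : normedModType R}.
Implicit Types (D C U : set V) (d : V -> V -> R).

Definition metric_on D d : Prop :=
  [/\ forall x y, D x -> D y -> 0 <= d x y,
      forall x y, D x -> D y -> (d x y = 0 <-> x = y),
      forall x y, D x -> D y -> d x y = d y x
    & forall x y z, D x -> D y -> D z -> d x z <= d x y + d y z].

Definition metric_open D d U : Prop :=
  U `<=` D /\
  forall x, U x -> exists2 r : R, 0 < r & forall y, D y -> d x y < r -> U y.

Definition same_topology D d : Prop :=
  forall U, metric_open D d U <-> exists2 O : set V, open O & U = O `&` D.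

(* As usual for quasi-geodesics, [gamma] is not assumed to be continuous. *)
Definition quasi_geodesic1 D d (kappa : R) : Prop :=
  forall x y, D x -> D y ->
  exists (a b : R) (gamma : R -> V),
    [/\ a <= b, gamma a = x, gamma b = y,
        forall t, t \in `[a, b] -> D (gamma t)
      & forall t1 t2, t1 \in `[a, b] -> t2 \in `[a, b] ->
          `|t1 - t2| - kappa <= d (gamma t1) (gamma t2) <= `|t1 - t2| + kappa].

Definition axiom1' D d : Prop :=
  same_topology D d /\
  forall w, D w ->
  forall (x : nat -> V) (xi : V), (forall n, D (x n)) -> bdry D xi ->
    x @ \oo --> xi -> d (x n) w @[n --> \oo] --> +oo.

Definition quasi_convex_metric D d : Prop :=
  forall x y z, D x -> D y -> D z -> forall s : R, 0 <= s <= 1 ->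
  d (s *: x + (1 - s) *: y) z <= Num.max (d x z) (d y z).

Definition metric_bounded d C : Prop :=
  exists M : R, forall x y, C x -> C y -> d x y <= M.

End MetricsOnASubset.

Section SelfMaps.
Context {R : realType} {V : normedModType R}.
Implicit Types (D : set V) (d : V -> V -> R) (g : V -> V).

Definition self_map D g : Prop := forall x, D x -> D (g x).

Definition nonexpansive D d g : Prop :=
  forall x y, D x -> D y -> d (g x) (g y) <= d x y.

Definition compact_map D g : Prop := compact (closure (g @` D)).

Definition Fix D g : set V := [set x | D x /\ g x = x].

Definition continuous_semigroup D (f : R -> V -> V) : Prop :=
  [/\ forall t, 0 <= t -> self_map D (f t),
      forall s t, 0 <= s -> 0 <= t -> forall x, D x ->
        f (s + t) x = f t (f s x),
      forall y, D y -> f 0 y = y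
    & forall y, D y -> f t y @[t --> 0^'+] --> y].

End SelfMaps.

(* Main.v *)
(* Write g = f_{t0} and z_n = g^n z. A bounded orbit would give a fixed point of
   g: the points eventually within a fixed distance of the orbit form a
   convex invariant set on which Schauder's theorem applies (Brouwer's theorem
   being obtained from Scarf's combinatorial lemma). By Calka's argument an
   orbit with a bounded subsequence is bounded, so d(z_n, z) tends to infinity.
   Strict convexity of D makes midpoints of sequences with distinct limits in
   the closure converge inside D, so that two such sequences satisfy
   d(x_n, w) <= d(x_n, y_n) + const; together with quasi-geodesics and
   Karlsson's record times this forces z_n to converge to a single boundary
   point xi. The same inequality transfers the convergence to all points at
   bounded distance from the orbit, uniformly. *)
Require Import Defs.
From HB Require Import structures.
From mathcomp Require Import all_boot all_order all_algebra zify.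

Set Implicit Arguments.
Unset Strict Implicit.
Unset Printing Implicit Defensive.

(** Modulo 2 only the odd summands survive; this turns the double count of doors and rooms into a
    parity statement. *)
Lemma odd_sumn (J : finType) (P : pred J) (F : J -> nat) :
  odd (\sum_(j | P j) F j) = odd #|[set j | P j & odd (F j)]|.
Proof.
rewrite (eq_bigr (fun j => (F j)./2.*2 + odd (F j))); last first.
  by move=> j _; rewrite addnC odd_double_half.
rewrite big_split /= oddD.
have -> : odd (\sum_(j | P j) (F j)./2.*2) = false.
  by apply: (big_ind (fun n => odd n = false)) => [//|x y|i _];
    [rewrite oddD => -> -> | rewrite odd_double].
rewrite /= -sum1_card; congr odd; rewrite -big_mkcondr.
by apply: eq_bigl => j; rewrite !inE.
Qed.

(** * Scarf's combinatorial lemma *)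

Section Scarf.
Variables (I T : finType) (r : I -> T -> nat).
Hypothesis r_inj : forall i, injective (r i).

(** Geometrically, the simplex bounded by the minima of [A] in the orders [r i] has no point of [T]
    strictly inside. *)
Definition dominated (A : {set T}) : bool :=
  [forall y, exists i, forall x in A, r i y <= r i x].

(* Scarf's primitive sets: they play the role of the full-dimensional
   simplices of a triangulation, with the linear orders [r i] replacing the
   geometry. *)
Definition room (A : {set T}) : bool := (#|A| == #|I|) && dominated A.

Lemma dominatedP (A : {set T}) :
  reflect (forall y, exists i, forall x, x \in A -> r i y <= r i x)
          (dominated A).
Proof.
apply: (iffP forallP) => H y.
  by have /existsP[i /forall_inP] := H y; exists i.
by have [i iP] := H y; apply/existsP; exists i; apply/forall_inP.
Qed.

Section Doors.
Variables (A : {set T}) (m : I -> T).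
Hypotheses (cardA : #|A|.+1 = #|I|) (mA : forall i, m i \in A).
Hypothesis m_min : forall i x, x \in A -> r i (m i) <= r i x.

(* In a room [x |: A] every point is the minimum of exactly one order, and
   [x] only takes over the order [k]: among the minima [m] of [A] the one at
   [k] is redundant. *)
Lemma room_vertex x : x \notin A -> room (x |: A) ->
  exists k, [/\ r k x < r k (m k), forall l, l != k -> r l (m l) < r l x
              & {in predC1 k &, injective m}].
Proof.
move=> xA /andP[_ /forallP dom].
(* For [y] in the room, [phi y] is an order in which [y] is lowest. On the room [phi] is injective,
   hence by cardinality a bijection onto [I]. *)
pose phi y := xchoose (existsP (dom y)).
have phiP y z : z \in x |: A -> r (phi y) y <= r (phi y) z.
  by move/forall_inP: (xchooseP (existsP (dom y))); apply.
have phi_inj : {in x |: A &, injective phi}.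
  move=> y z yA zA e; apply: (r_inj (i := phi y)); apply/eqP.
  by rewrite eqn_leq phiP // e phiP.
have phi_surj l : exists2 y, y \in x |: A & phi y = l.
  have /eqP e : phi @: (x |: A) == setT.
    by rewrite eqEcard subsetT card_in_imset // cardsU1 xA cardsT -cardA add1n leqnn.
  have : l \in phi @: (x |: A) by rewrite e inE.
  by case/imsetP => y yA ->; exists y.
have phi_m l : l != phi x -> phi (m l) = l.
  have [y] := phi_surj l; rewrite in_setU1 => /orP[/eqP-> <-|yA yl _].
    by rewrite eqxx.
  suff -> : m l = y by [].
  apply: (r_inj (i := l)); apply/eqP; rewrite eqn_leq m_min //=.
  by have := phiP y (m l); rewrite yl in_setU1 mA orbT; apply.
have neq y : y \in A -> x != y by apply: contraTneq => <-.
exists (phi x); split.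
- rewrite ltn_neqAle (inj_eq (@r_inj _)) neq ?mA //=.
  by rewrite phiP // in_setU1 mA orbT.
- move=> l lk; rewrite ltn_neqAle (inj_eq (@r_inj _)) eq_sym neq ?mA //=.
  by have := phiP (m l) x; rewrite phi_m // setU11; apply.
- by move=> l l' lk l'k /(congr1 phi); rewrite !phi_m.
Qed.

(* Two indices have the same minimum in [A]; each of them yields one room, by
   adding the largest point that is above the other minima. *)
Lemma door_two_rooms x0 : x0 \notin A -> room (x0 |: A) ->
    (forall j, exists y, forall l, l != j -> r l (m l) < r l y) ->
  #|[set x | (x \notin A) && room (x |: A)]| = 2.
Proof.
move=> x0A room0 Mn0.
have [k [x0k x0l injk]] := room_vertex x0A room0.
have imk : m @: [set~ k] = A.
  apply/eqP; rewrite eqEcard; apply/andP; split.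
    by apply/subsetP => _ /imsetP[l _ ->].
  rewrite card_in_imset; last by move=> l l'; rewrite !in_setC1; apply: injk.
  by rewrite cardsC1 -cardA.
have [j jk mj] : exists2 j, j != k & m j = m k.
  have : m k \in m @: [set~ k] by rewrite imk.
  by case/imsetP => j; rewrite in_setC1 => jk e; exists j.
have imj z : z \in A -> exists2 l, l != j & z = m l.
  rewrite -imk => /imsetP[l]; rewrite in_setC1 => lk ->.
  have [->|lj] := eqVneq l j; first by exists k; rewrite // eq_sym.
  by exists l.
have /dominatedP dom0 : dominated (x0 |: A) by case/andP: room0.
have [y0 y0M] := Mn0 j.
(* Dropping the constraint of the order [j] leaves the candidates [M]; the second vertex is the
   highest of them in that order. *)
pose M y := [forall (l | l != j), r l (m l) < r l y].
have M0 : M y0 by apply/forall_inP.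
case: (arg_maxnP (r j) M0) => x1 /forall_inP x1M x1max.
have x1A : x1 \notin A.
  apply: contraTN isT => /imj[l lj e].
  by have := x1M l lj; rewrite e ltnn.
have x1j z : z \in A -> r j x1 <= r j z.
  move=> zA; have [i iP] := dom0 x1.
  have [<-|ij] := eqVneq i j; first by rewrite iP // in_setU1 zA orbT.
  have := iP (m i); rewrite in_setU1 mA orbT => /(_ isT).
  by rewrite leqNgt x1M.
have room1 : room (x1 |: A).
  rewrite /room cardsU1 x1A -cardA eqxx; apply/dominatedP => y.
  have [yM|] := boolP (M y).
    exists j => z /setU1P[->|zA]; first exact: x1max.
    exact: leq_trans (x1max _ yM) (x1j _ zA).
  rewrite negb_forall => /existsP[l]; rewrite negb_imply -leqNgt => /andP[lj yl].
  exists l => z /setU1P[->|zA].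
    exact: leq_trans yl (ltnW (x1M _ lj)).
  exact: leq_trans yl (m_min _ zA).
have x01 : x0 != x1.
  apply: contraTneq x0k => ->; rewrite -leqNgt ltnW // x1M // eq_sym //.
suff -> : [set x | (x \notin A) && room (x |: A)] = [set x0; x1].
  by rewrite cards2 x01.
apply/setP => x; rewrite !inE; apply/idP/idP; last first.
  by case/orP => /eqP->; rewrite ?x0A ?x1A.
case/andP => xA roomx; have [k' [xk xl injk']] := room_vertex xA roomx.
have /dominatedP dom : dominated (x |: A) by case/andP: roomx.
(* Away from [k'] the minima are distinct, whereas [m j = m k]. *)
have /orP[/eqP ek|/eqP ej] : (k' == k) || (k' == j).
  apply: contraNT jk; rewrite negb_or => /andP[kk kj].
  by apply/eqP; apply: injk' => //; rewrite inE eq_sym.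
- apply/orP; left; subst k'; apply/eqP/(r_inj (i := k))/eqP.
  rewrite eqn_leq; apply/andP; split.
    have [i iP] := dom0 x; have [<-|ik] := eqVneq i k.
      by rewrite iP // setU11.
    have := iP (m i); rewrite in_setU1 mA orbT => /(_ isT).
    by rewrite leqNgt xl.
  have [i iP] := dom x0; have [<-|ik] := eqVneq i k.
    by rewrite iP // setU11.
  have := iP (m i); rewrite in_setU1 mA orbT => /(_ isT).
  by rewrite leqNgt x0l.
- apply/orP; right; subst k'; apply/eqP/(r_inj (i := j))/eqP.
  rewrite eqn_leq; apply/andP; split.
    by apply: x1max; apply/forall_inP.
  have [i iP] := dom x1; have [<-|ik] := eqVneq i j.
    by rewrite iP // setU11.
  have := iP (m i); rewrite in_setU1 mA orbT => /(_ isT).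
  by rewrite leqNgt x1M.
Qed.

End Doors.

(* [s i] is the slack element of the index [i], standing for the facet of the
   simplex on which the [i]-th coordinate vanishes. *)
Variables (s : I -> T) (c : T -> I) (t0 : T) (i0 : I).
Hypothesis cs : cancel s c.
Hypothesis s_min : forall i y, r i (s i) <= r i y.
Hypothesis s_max : forall i j y, i != j -> y \notin codom s -> r i y < r i (s j).
Hypothesis t0_inner : t0 \notin codom s.
Hypothesis card_gt1 : 1 < #|I|.

(** In Sperner's parity argument these are the facets carrying every colour but [i0]. *)
Definition door (A : {set T}) : bool :=
  (#|A|.+1 == #|I|) && (c @: A == [set~ i0]).

Definition outer_door : {set T} := s @: [set~ i0].

Let s_inj : injective s. Proof. exact: can_inj cs. Qed.

Lemma outer_doorE A : door A -> A \subset codom s -> A = outer_door.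
Proof.
case/andP=> _ /eqP cA /subsetP sub.
have scA x : x \in A -> s (c x) = x by move=> /sub/codomP[i ->]; rewrite cs.
apply/setP=> x; apply/idP/imsetP => [xA|[i]].
  by exists (c x); rewrite ?scA // -cA imset_f.
by rewrite -cA => /imsetP[y yA ->] ->; rewrite scA.
Qed.

Lemma door_outer_door : door outer_door.
Proof.
rewrite /door card_imset // cardsC1 prednK ?eqxx ?(ltn_trans _ card_gt1) //=.
rewrite -imset_comp (eq_imset _ (g := id)) ?imset_id //; exact: cs.
Qed.

(** Each slack of the outer door is the bottom of its own order, so only the order [i0] constrains
    the added vertex: it must be the largest point outside the door. *)
Lemma outer_door_room :
  #|[set x | (x \notin outer_door) && room (x |: outer_door)]| = 1.
Proof.
have t0O : t0 \notin outer_door.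
  by apply: contra t0_inner => /imsetP[i _ ->]; apply: codom_f.
have sO l : l != i0 -> s l \in outer_door by move=> l0; rewrite imset_f ?inE.
case: (arg_maxnP (r i0) (P := [pred y | y \notin outer_door]) t0O) => x /= xO xmax.
suff -> : [set x | (x \notin outer_door) && room (x |: outer_door)] = [set x].
  by rewrite cards1.
apply/setP => z; rewrite !inE; apply/andP/eqP => [[zO /andP[_ /dominatedP dom]]|->].
  have [i iP] := dom x; have [e|ii0] := eqVneq i i0.
    apply: (r_inj (i := i0)); apply/eqP; rewrite eqn_leq xmax //=.
    by move: (iP z (setU11 _ _)); rewrite e.
  have := iP (s i); rewrite in_setU1 sO // orbT => /(_ isT) xs.
  have xsi : x = s i.
    by apply: (r_inj (i := i)); apply/eqP; rewrite eqn_leq xs s_min.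
  by move: xO; rewrite xsi sO.
split=> //; rewrite /room cardsU1 xO add1n.
have /andP[-> _] := door_outer_door; apply/dominatedP => y.
have [/imsetP[l _ ->]|yO] := boolP (y \in outer_door).
  by exists l => w _; apply: s_min.
exists i0 => w /setU1P[->|]; first exact: xmax.
case/imsetP => l; rewrite !inE => li0 ->.
have [/codomP[i yi]|ys] := boolP (y \in codom s); last first.
  by rewrite ltnW // s_max // eq_sym.
have [e|ii0] := eqVneq i i0; first by rewrite yi e s_min.
by move: yO; rewrite yi sO.
Qed.

Lemma door_rooms A : door A ->
  odd #|[set x | (x \notin A) && room (x |: A)]| = (A == outer_door).
Proof.
move=> doorA; have [->|AO] := eqVneq A outer_door.
  by rewrite outer_door_room.
have [cardA cA] : #|A|.+1 = #|I| /\ c @: A = [set~ i0].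
  by case/andP: doorA => /eqP ? /eqP.
have [->|[x0]] := set_0Vmem [set x | (x \notin A) && room (x |: A)].
  by rewrite cards0.
rewrite inE => /andP[x0A room0].
have [y0 y0A] : exists y, y \in A.
  by apply/set0Pn; rewrite -card_gt0 -ltnS cardA.
pose m i := [arg min_(x < y0 in A) r i x].
have mA i : m i \in A by rewrite /m; case: arg_minnP.
have m_min i x : x \in A -> r i (m i) <= r i x.
  by rewrite /m; case: arg_minnP => // z _ zmin; apply: zmin.
(* If [s j] did not exceed [m l], then [m l] would be a slack other than [s l]; as it is minimal,
   all of [A] would consist of slacks and be the outer door. *)
rewrite (@door_two_rooms A m cardA mA m_min x0) // => j; exists (s j) => l lj.
rewrite ltnNge; apply: contra AO => sj.
have [/codomP[a ma]|mls] := boolP (m l \in codom s); last first.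
  by move: sj; rewrite leqNgt s_max.
apply/eqP/(outer_doorE doorA)/subsetP => x xA.
apply: contraT => xs; move: (m_min l x xA); rewrite leqNgt ma s_max //.
apply: contra_neq lj => la; apply: s_inj; apply: (r_inj (i := l)); apply/eqP.
by rewrite eqn_leq s_min /=; move: sj; rewrite ma -la.
Qed.

(** If removing [x0] leaves a door, the colour of [x0] is not [i0] and repeats that of exactly one
    other point [x1]. Removing [x0] or [x1] are then the only ways to leave a door. *)
Lemma room_doors (A : {set T}) : #|A| = #|I| -> c @: A != setT ->
  ~~ odd #|[set x in A | door (A :\ x)]|.
Proof.
move=> cardA cA.
have [->|[x0]] := set_0Vmem [set x in A | door (A :\ x)].
  by rewrite cards0.
rewrite inE => /andP[x0A /andP[/eqP card0 /eqP c0]].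
have inj0 : {in A :\ x0 &, injective c}.
  by apply/imset_injP; rewrite c0 cardsC1 -card0.
have AE : c @: A = c x0 |: [set~ i0] by rewrite -c0 -imsetU1 setD1K.
have cx0 : c x0 != i0.
  apply: contra cA => /eqP e; rewrite AE e; apply/eqP/setP => i.
  by rewrite !inE orbN.
have : c x0 \in c @: (A :\ x0) by rewrite c0 !inE.
case/imsetP => x1; rewrite !inE => /andP[x10 x1A] cx.
suff -> : [set x in A | door (A :\ x)] = [set x0; x1].
  by rewrite cards2 eq_sym x10.
apply/setP => x; rewrite !inE; apply/andP/orP => [[xA /andP[/eqP cardx /eqP cAx]]|].
  have inj : {in A :\ x &, injective c}.
    by apply/imset_injP; rewrite cAx cardsC1 -cardx.
  apply/orP; apply: contraNT x10; rewrite negb_or => /andP[xx0 xx1].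
  by apply/eqP; apply: inj; rewrite ?inE // 1?eq_sym ?xx0 ?xx1.
case=> /eqP ->; first by split=> //; rewrite /door card0 c0 !eqxx.
split=> //; apply/andP; split.
  by rewrite -cardA [in X in _ == X](cardsD1 x1) x1A.
rewrite -c0; apply/eqP/setP => i.
apply/imsetP/imsetP => -[y]; rewrite !inE => /andP[yx yA] ->.
  have [->|yx0] := eqVneq y x0; last by exists y; rewrite ?inE ?yx0.
  by exists x1; rewrite ?inE ?x10.
have [->|yx1] := eqVneq y x1; last by exists y; rewrite ?inE ?yx1.
by exists x0; rewrite ?inE 1?eq_sym ?x10.
Qed.

(* Parity: pairs of a door and a room containing it, counted by doors and by
   rooms; only the outer door lies in an odd number of rooms. *)
Theorem rainbow_room : exists A : {set T}, room A && (c @: A == setT).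
Proof.
apply/existsP; apply: contraT; rewrite negb_exists => /forallP noA.
pose F (A : {set T}) x : nat := door (A :\ x) && room A.
have : \sum_(A : {set T}) \sum_(x | x \notin A) (door A && room (x |: A) : nat)
     = \sum_(A : {set T}) \sum_(x in A) F A x.
  rewrite (exchange_big_dep xpredT) // [RHS](exchange_big_dep xpredT) //=.
  apply: eq_bigr => x _.
  rewrite (reindex_onto (fun A => A :\ x) (fun A => x |: A)) /=; last first.
    by move=> A xA; rewrite setU1K.
  apply: eq_big => [A|A /andP[_ /eqP->] //].
  rewrite in_setD1 eqxx /=; apply/eqP/idP => [<-|xA]; first exact: setU11.
  by rewrite setD1K.
move/(congr1 odd); rewrite !odd_sumn.
have -> : [set A : {set T} | xpredT A
            & odd (\sum_(x | x \notin A) (door A && room (x |: A)))]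
          = [set outer_door].
  apply/setP => A; rewrite !inE /=.
  have [dA|dA] := boolP (door A).
    rewrite -door_rooms // -sum1_card; congr odd; rewrite -big_mkcondr.
    by apply: eq_bigl => x; rewrite inE.
  rewrite big1 //; apply/esym; apply: contraNF dA => /eqP ->.
  exact: door_outer_door.
have -> : [set A : {set T} | xpredT A & odd (\sum_(x in A) F A x)] = set0.
  apply/setP => A; rewrite !inE /=; apply/negbTE.
  have [rA|rA] := boolP (room A); last first.
    by rewrite big1 // => x _; rewrite /F (negbTE rA) andbF.
  under eq_bigr do rewrite /F rA andbT.
  rewrite -big_mkcondr sum1_card.
  have := noA A; rewrite rA /= => /room_doors; rewrite cardsE; apply.
  by case/andP: rA => /eqP.
by rewrite cards1 cards0.
Qed.
End Scarf.

(** * Sperner's lemma on the integer grid of a simplex *)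

Section Grid.
Variables k m : nat.

Definition grid := {a : {ffun 'I_k -> 'I_m.+1} | \sum_i a i == m}.

Definition grid_coord (i : 'I_k) (a : grid) : nat := val a i.

Lemma sum_grid_coord a : \sum_i grid_coord i a = m.
Proof. exact/eqP/(valP a). Qed.

Lemma grid_coord_le i a : grid_coord i a <= m.
Proof. by rewrite -ltnS ltn_ord. Qed.

Lemma grid_above (i0 : 'I_k) (b : 'I_k -> nat) : \sum_i b i <= m ->
  exists a : grid, forall i, b i <= grid_coord i a.
Proof.
move=> bm; pose e i := b i + (i == i0) * (m - \sum_j b j).
have se : \sum_i e i = m.
  have s1 : \sum_i (i == i0) = 1.
    by rewrite (bigD1 i0) //= eqxx big1 // => i /negbTE->.
  by rewrite big_split /= -big_distrl /= s1 mul1n subnKC.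
have em i : e i < m.+1 by rewrite ltnS -[leqRHS]se (bigD1 i) //= leq_addr.
pose a : {ffun 'I_k -> 'I_m.+1} := [ffun i => Ordinal (em i)].
have am : \sum_i a i == m.
  by apply/eqP; rewrite -[RHS]se; apply: eq_bigr => i _; rewrite ffunE.
exists (exist (fun a : {ffun 'I_k -> 'I_m.+1} => \sum_i a i == m) a am) => i.
by rewrite /grid_coord /= ffunE leq_addr.
Qed.

(* Ties of the [i]-th coordinate are broken by the enumeration of the grid. *)
Definition grid_rank (i : 'I_k) (y : grid + 'I_k) : nat :=
  match y with
  | inl a => (grid_coord i a * #|{: grid}| + enum_rank a).+1
  | inr j => if j == i then 0 else (m.+1 * #|{: grid}| + j).+1
  end.

Lemma grid_rank_lt i (a b : grid) :
  grid_coord i a < grid_coord i b -> grid_rank i (inl a) < grid_rank i (inl b).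
Proof.
move=> ab /=; rewrite ltnS.
apply: (@leq_trans ((grid_coord i a).+1 * #|{: grid}|)).
  by rewrite mulSn addnC ltn_add2r.
by rewrite (leq_trans _ (leq_addr _ _)) // leq_mul2r ab orbT.
Qed.

Lemma grid_rank_slack i j a : i != j -> grid_rank i (inl a) < grid_rank i (inr j).
Proof.
move=> ij /=; rewrite eq_sym (negbTE ij) ltnS.
apply: (@leq_trans ((grid_coord i a).+1 * #|{: grid}|)).
  by rewrite mulSn addnC ltn_add2r.
rewrite (leq_trans _ (leq_addr _ _)) // leq_mul2r ltnS grid_coord_le orbT //.
Qed.

Lemma grid_rank_inj i : injective (grid_rank i).
Proof.
move=> [a|j] [b|l].
- move=> ab; congr inl.
  have [lt|lt|e] := ltngtP (grid_coord i a) (grid_coord i b).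
  + by move/grid_rank_lt: lt; rewrite ab ltnn.
  + by move/grid_rank_lt: lt; rewrite ab ltnn.
  by move: ab => /= [] /eqP; rewrite e eqn_add2l => /eqP/val_inj/enum_rank_inj.
- have [<-|il] := eqVneq i l; first by rewrite /= eqxx.
  by move=> e; have := grid_rank_slack a il; rewrite e ltnn.
- have [<-|ij] := eqVneq i j; first by rewrite /= eqxx.
  by move=> e; have := grid_rank_slack b ij; rewrite e ltnn.
- rewrite /=; case: eqVneq => [->|_]; case: eqVneq => [->|_] //.
  by move=> [] /eqP; rewrite eqn_add2l => /eqP/val_inj->.
Qed.

(** In a rainbow room, with each slack coloured by its own index, colour [i] comes from a grid point
    or from the slack [inr i]. Comparing coordinate sums with [m] bounds the width of the room by
    [k]. *)
Theorem grid_sperner (label : grid -> 'I_k) : 1 < k ->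
  exists p : grid, forall i,
    (exists2 x, label x = i
       & forall j, grid_coord j x <= grid_coord j p + k
                /\ grid_coord j p <= grid_coord j x + k)
    \/ grid_coord i p <= k.
Proof.
move=> k1.
pose i0 : 'I_k := Ordinal (ltnW k1).
pose c (y : grid + 'I_k) := match y with inl a => label a | inr j => j end.
have [|y0 _] := @grid_above i0 (fun=> 0); first by rewrite big1.
have y0P : inl y0 \notin codom (@inr grid 'I_k) by apply/codomP => -[].
have [A /andP[/andP[/eqP cardA /dominatedP dom] /eqP cA]] :
    exists A, room grid_rank A && (c @: A == setT).
  apply: (rainbow_room grid_rank_inj (s := @inr grid 'I_k) (t0 := inl y0) i0).
  - by [].
  - by move=> i y; rewrite /= eqxx.
  - move=> i j [a|l] ij; last by rewrite codom_f.
    by move=> _; apply: grid_rank_slack.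
  - by [].
  - by rewrite card_ord.
(* A slack is the bottom of its own order, so an order whose slack is in the room cannot dominate a
   grid point. *)
have domC y : exists2 i, inr i \notin A &
    forall x, inl x \in A -> grid_coord i y <= grid_coord i x.
  have [i iP] := dom (inl y); exists i.
    by apply/negP => /iP; rewrite /= eqxx.
  by move=> x /iP; rewrite leqNgt; apply: contraNT; rewrite -ltnNge; exact: grid_rank_lt.
have [p pA] : exists p, inl p \in A.
  have [i iA _] := domC y0; apply/existsP; apply: contraT.
  rewrite negb_exists => /forallP nA.
  have sub : A \subset [set inr j | j in [set~ i]].
    apply/subsetP => -[a|j] yA; first by have := nA a; rewrite yA.
    by rewrite imset_f // !inE; apply: contraNneq iA => <-.
  move/subset_leq_card: sub; rewrite card_imset; last by move=> ? ? [].
  by rewrite cardsC1 cardA !card_ord -ltnS prednK ?ltnn // ltnW.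
pose a i := grid_coord i [arg min_(x < p | inl x \in A) grid_coord i x].
have a_le i x : inl x \in A -> a i <= grid_coord i x.
  by rewrite /a; case: arg_minnP => // z _ zmin; apply: zmin.
have aE i : exists2 x, inl x \in A & a i = grid_coord i x.
  by rewrite /a; case: arg_minnP => // z zA _; exists z.
pose C i := inr i \notin A.
(* Otherwise [grid_above] gives a grid point exceeding [a i] for all [i] in [C], against
   domination. *)
have aC : m < \sum_(i | C i) (a i).+1.
  rewrite ltnNge; apply/negP; rewrite big_mkcond => /(grid_above i0)[y yP].
  have [i iC yi] := domC y; have [x xA ax] := aE i.
  by have := yP i; rewrite /C iC ax => /leq_trans/(_ (yi x xA)); rewrite ltnn.
have aCk : m < \sum_(i | C i) a i + k.
  apply: leq_trans aC _; under eq_bigr do rewrite -addn1.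
  by rewrite big_split /= leq_add2l sum1_card (leq_trans (max_card _)) ?card_ord.
have aux (u v w x b l : nat) : u <= v -> x + v + w < b + u + l -> x <= b + l by lia.
have aux' (u v w x l : nat) : u <= v -> v + (x + w) < u + l -> x <= l by lia.
have boundC i x : C i -> inl x \in A -> grid_coord i x <= a i + k.
  move=> iC xA; move: aCk; rewrite -[X in X < _](sum_grid_coord x).
  rewrite (bigID C) /= (bigD1 i) //= [in ltnRHS](bigD1 i) //=.
  have : \sum_(j | C j && (j != i)) a j <= \sum_(j | C j && (j != i)) grid_coord j x.
    by apply: leq_sum => j _; apply: a_le.
  exact: aux.
have boundNC i x : ~~ C i -> inl x \in A -> grid_coord i x <= k.
  move=> iC xA; move: aCk; rewrite -[X in X < _](sum_grid_coord x).
  rewrite (bigID C) /= [X in _ + X](bigD1 i) //=.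
  have : \sum_(j | C j) a j <= \sum_(j | C j) grid_coord j x.
    by apply: leq_sum => j _; apply: a_le.
  exact: aux'.
exists p => i.
have /imsetP[[x|j] yA ei] : i \in c @: A by rewrite cA.
  left; exists x => // j.
  have [jC|jC] := boolP (C j).
    have := boundC j x jC yA; have := boundC j p jC pA.
    by have := a_le j x yA; have := a_le j p pA; lia.
  by have := boundNC j x jC yA; have := boundNC j p jC pA; lia.
by right; apply: boundNC => //; rewrite /C ei negbK.
Qed.

End Grid.

From mathcomp Require Import all_classical all_reals all_analysis.
From mathcomp Require Import lra.
Import Order.TTheory GRing.Theory Num.Theory.
Import numFieldNormedType.Exports.
Local Open Scope classical_set_scope.
Local Open Scope ring_scope.

(** * Brouwer and Schauder approximation *)

Definition simplex {R : numDomainType} {k : nat} (u : 'I_k -> R) : Prop :=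
  (forall i, 0 <= u i) /\ \sum_i u i = 1.

Lemma simplex_le1 (R : numDomainType) k (u : 'I_k -> R) i :
  simplex u -> u i <= 1.
Proof.
by case=> u0 <-; rewrite (bigD1 i) //= lerDl; apply: sumr_ge0 => j _.
Qed.

Lemma convex_comb (R : realFieldType) (V : lmodType R) (A : set V)
    (k : nat) (y : 'I_k -> V) (u : 'I_k -> R) :
    (forall x z (s : R), A x -> A z -> 0 <= s <= 1 -> A (s *: x + (1 - s) *: z)) ->
  (forall i, A (y i)) -> simplex u -> A (\sum_i u i *: y i).
Proof.
move=> Acvx; elim: k y u => [|k IH] y u Ay [u0 u1].
  by move: u1; rewrite big_ord0 => /esym/eqP; rewrite oner_eq0.
have uS : \sum_(i < k) u (lift ord0 i) = 1 - u ord0.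
  by rewrite -u1 big_ord_recl addrAC subrr add0r.
rewrite big_ord_recl; have [e|ne] := eqVneq (u ord0) 1.
  rewrite big1 ?addr0 ?e ?scale1r // => i _.
  move/eqP: uS; rewrite e subrr psumr_eq0 // => /allP/(_ i).
  by rewrite mem_index_enum => /(_ isT)/eqP->; rewrite scale0r.
have u01 : u ord0 <= 1 by apply: simplex_le1.
have u1n : 1 - u ord0 != 0 by rewrite subr_eq0 eq_sym.
pose v i := u (lift ord0 i) / (1 - u ord0).
have -> : \sum_(i < k) u (lift ord0 i) *: y (lift ord0 i)
   = (1 - u ord0) *: \sum_(i < k) v i *: y (lift ord0 i).
  rewrite scaler_sumr; apply: eq_bigr => i _.
  by rewrite scalerA /v mulrC divfK.
apply: Acvx => //; last by rewrite u0.
apply: IH => //; split=> [i|].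
  by rewrite divr_ge0 // subr_ge0.
by rewrite -mulr_suml uS divff.
Qed.

(** Each point of the grid of mesh [1 / m.+1] is labelled by a member of the cover containing it. *)
Lemma simplex_sperner (R : archiRealFieldType) (k m : nat)
    (G : 'I_k -> ('I_k -> R) -> Prop) : (1 < k)%N ->
    (forall u, simplex u -> exists i, G i u) ->
  exists2 p : 'I_k -> R, simplex p & forall i,
    (exists u, [/\ simplex u, G i u & forall j, `|u j - p j| <= k%:R / m.+1%:R])
    \/ p i <= k%:R / m.+1%:R.
Proof.
move=> k1 Gcover.
pose w (a : grid k m.+1) (i : 'I_k) : R := (grid_coord i a)%:R / m.+1%:R.
have wS a : simplex (w a).
  split=> [i|]; first by rewrite divr_ge0.
  by rewrite -mulr_suml -natr_sum sum_grid_coord divff.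
pose label a := xget (Ordinal k1) [set i | G i (w a)].
have labelP a : G (label a) (w a).
  by rewrite /label; have /(xgetPex (Ordinal k1)) := Gcover _ (wS a).
have [p pP] := grid_sperner label k1.
exists (w p) => // i; have [[x <- xp]|pi] := pP i; [left|right].
  exists (w x); split=> // j; have := xp j; rewrite -!(ler_nat R) !natrD => -[xp1 xp2].
  rewrite -mulrBl normrM [X in _ * X]ger0_norm // ler_pM2r //.
  by rewrite ler_norml; lra.
by rewrite /w ler_pM2r // ler_nat.
Qed.

(** A cluster point of an ultrafilter is a limit of it. *)
Lemma compact_ultra_cvg (X : topologicalType) (K : set X) (J : Type)
    (U : set_system J) (u : J -> X) :
  UltraFilter U -> compact K -> (\forall j \near U, K (u j)) ->
  exists2 l, K l & u @ U --> l.
Proof.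
move=> UU cK Ku; have [l [Kl lU]] := cK _ (fmap_proper_filter u _) Ku.
exists l => // B lB.
have [//|UB] := in_ultra_setVsetC (u @^-1` B) UU.
by have [x [nBx Bx]] := lU (~` B) B UB lB.
Qed.

(* Limits are taken along an ultrafilter, which avoids extracting
   subsequences. *)
Lemma simplex_cover (R : realType) (k : nat) (G : 'I_k -> ('I_k -> R) -> Prop) :
    (1 < k)%N -> (forall u, simplex u -> exists i, G i u) ->
  exists (U : set_system nat) (p : 'I_k -> R),
    [/\ UltraFilter U, simplex p & forall i, p i = 0 \/
      exists u : nat -> 'I_k -> R,
        [/\ forall n, simplex (u n), \forall n \near U, G i (u n)
          & forall j, u n j @[n --> U] --> p j]].
Proof.
move=> k1 Gcover.
have /choice[q qP] : forall m, exists p : 'I_k -> R, simplex p /\ forall i,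
    (exists u, [/\ simplex u, G i u & forall j, `|u j - p j| <= k%:R / m.+1%:R])
    \/ p i <= k%:R / m.+1%:R.
  by move=> m; have [p] := @simplex_sperner R k m G k1 Gcover; exists p.
have [U [UU oU]] := ultraFilterLemma eventually_filter.
have qS m : simplex (q m) by have [] := qP m.
have /choice[p pP] : forall i, exists l : R, 0 <= l /\ q m i @[m --> U] --> l.
  move=> i; have [|l] := @compact_ultra_cvg R `[(0 : R), 1]%classic nat U (q^~ i)
    UU (@segment_compact R 0 1).
    apply: filterE => m /=.
    by rewrite in_itv /= simplex_le1 // andbT; have [] := qS m.
  by rewrite /= in_itv /= => /andP[l0 _]; exists l.
have kU : (k%:R / m.+1%:R : R) @[m --> U] --> (0 : R).
  apply: (@cvg_trans _ ((k%:R / m.+1%:R : R) @[m --> \oo])).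
    by move=> B; apply: oU.
  have : (k%:R * harmonic m : R) @[m --> \oo] --> (k%:R * 0 : R).
    by apply: cvgMr; apply: cvg_harmonic.
  by rewrite mulr0.
have pS : simplex p.
  split=> [i|]; first by have [] := pP i.
  have : \sum_i q m i @[m --> U] --> \sum_i p i.
    by apply: cvg_big => [|i _]; [exact: add_continuous | have [] := pP i].
  have -> : (fun m => \sum_i q m i) = fun=> 1 by apply/funext => m; have [] := qS m.
  by move/cvg_lim => <- //; rewrite lim_cst.
exists U, p; split=> // i.
pose near_q m (u : 'I_k -> R) := forall j, `|u j - q m j| <= k%:R / m.+1%:R.
have [Ui|Ui] := in_ultra_setVsetC
    [set m | exists u, [/\ simplex u, G i u & near_q m u]] UU; [right|left].
  (* At the indices [m] without a suitable point, [u m] defaults to [q m], which keeps it in the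
     simplex and near [q m]. *)
  have /choice[u uP] : forall m, exists u, [/\ simplex u, near_q m u &
    (exists u, [/\ simplex u, G i u & near_q m u]) -> G i u].
    move=> m; have [[u [uS uG uq]]|no] :=
      pselect (exists u, [/\ simplex u, G i u & near_q m u]).
      by exists u.
    exists (q m); split=> // j.
    by rewrite subrr normr0 divr_ge0.
  exists u; split=> [m||j].
  - by have [] := uP m.
  - by apply: filterS Ui => m; have [_ _] := uP m.
  have -> : u^~ j = (fun m => q m j + (u m j - q m j)).
    by apply/funext => m; rewrite addrC subrK.
  suff : (u m j - q m j) @[m --> U] --> (0 : R).
    by move=> /(cvgD (pP j).2); rewrite addr0.
  apply/cvgr0Pnorm_le => e e0.
  have := kU; move/cvgr0Pnorm_le => /(_ e e0); apply: filterS => m.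
  have [_ /(_ j) uq _] := uP m.
  by rewrite [X in X <= _ -> _]ger0_norm ?divr_ge0 //; apply: le_trans.
have [pi0 pi] := pP i; apply/eqP; rewrite eq_le pi0 andbT.
apply: ler_cvg_to pi kU _; apply: filterS Ui => m no.
by have [_ /(_ i)[]] := qP m.
Qed.

(* The weights [b i x] are a multiple of a partition of unity subordinate to
   the balls around the points [y i]; a simplex point whose coordinates are
   proportional to its own weights is an approximate fixed point. *)
Lemma schauder_approx (R : realType) (V : normedModType R) (A : set V)
    (h : V -> V) (eps : R) (k : nat) (y : 'I_k -> V) (x0 : V) :
    (forall x z (s : R), A x -> A z -> 0 <= s <= 1 -> A (s *: x + (1 - s) *: z)) ->
    (forall x, A x -> {for x, continuous h}) ->
    (forall i, A (y i)) -> (forall x, A x -> exists i, `|h x - y i| < eps) ->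
  A x0 -> exists2 x, A x & `|h x - x| <= eps.
Proof.
move=> Acvx hcont Ay net Ax0; have [i0 _] := net x0 Ax0.
(* [simplex_cover] needs two vertices; a single net point is within [eps] of its own image. *)
have [k1|k1] := ltnP 1 k; last first.
  exists (y i0) => //; have [j hj] := net _ (Ay i0).
  suff ij : i0 = j by rewrite {2}ij ltW.
  have z (i : 'I_k) : val i = 0%N.
    by apply/eqP; rewrite -leqn0 -ltnS (leq_trans (ltn_ord i)).
  by apply: val_inj; rewrite !z.
pose b i x : R := (eps - `|h x - y i|) + `|eps - `|h x - y i| |.
have b_ge0 i x : 0 <= b i x.
  by rewrite /b; have := ler_norm (- (eps - `|h x - y i|)); rewrite normrN; lra.
pose S x := \sum_i b i x.
pose pt (u : 'I_k -> R) := \sum_i u i *: y i.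
have [|U [p [UU pS pP]]] :=
  @simplex_cover R k (fun i u => S (pt u) * u i <= b i (pt u)) k1.
  (* If no index worked, summing the strict inequalities would give [S (pt u) < S (pt u)]. *)
  move=> u [u0 u1]; apply: contrapT => no.
  have lt i : b i (pt u) < S (pt u) * u i.
    by rewrite ltNge; apply/negP => le; apply: no; exists i.
  have : S (pt u) < \sum_i S (pt u) * u i.
    rewrite /S; apply: ltr_sum => //.
    by apply/hasP; exists i0; rewrite ?mem_index_enum.
  by rewrite -mulr_sumr u1 mulr1 ltxx.
have Apt u : simplex u -> A (pt u) by exact: convex_comb.
have Ap := Apt _ pS.
have Sp i : S (pt p) * p i <= b i (pt p).
  case: (pP i) => [->|[u [uS uG up]]]; first by rewrite mulr0.
  have ptu : pt (u n) @[n --> U] --> pt p.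
    apply: cvg_big => [|j _]; first exact: add_continuous.
    by apply: cvgZr_tmp; exact: up.
  have hu : h (pt (u n)) @[n --> U] --> h (pt p).
    by apply: continuous_cvg; [exact: hcont | exact: ptu].
  have bu j : b j (pt (u n)) @[n --> U] --> b j (pt p).
    have cw : (eps - `|h (pt (u n)) - y j|) @[n --> U] --> (eps - `|h (pt p) - y j|).
      apply: cvgB; first exact: cvg_cst.
      by apply: cvg_norm; apply: cvgB => //; exact: cvg_cst.
    by apply: cvgD => //; apply: cvg_norm.
  apply: (ler_cvg_to _ (bu i) uG).
  apply: cvgM; last exact: up.
  by apply: cvg_big => [|j _]; [exact: add_continuous | exact: bu].
have [p0 p1] := pS.
(* Both sides of [Sp] have the same sum over [i], so every inequality is an equality. *)
have bE i : b i (pt p) = S (pt p) * p i.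
  have : \sum_i (b i (pt p) - S (pt p) * p i) == 0.
    by rewrite sumrB -mulr_sumr p1 mulr1 subrr.
  rewrite psumr_eq0 => [|j _]; last by rewrite subr_ge0.
  by move/allP/(_ i); rewrite mem_index_enum => /(_ isT); rewrite subr_eq0 => /eqP.
have S_gt0 : 0 < S (pt p).
  have [i hi] := net _ Ap; rewrite /S (bigD1 i) //= ltr_pwDl //.
    by rewrite /b gtr0_norm; lra.
  by apply: sumr_ge0.
exists (pt p) => //.
have -> : h (pt p) - pt p = \sum_i p i *: (h (pt p) - y i).
  under eq_bigr do rewrite scalerBr.
  by rewrite sumrB -scaler_suml p1 scale1r.
apply: (le_trans (ler_norm_sum _ _ _)).
rewrite -[leRHS]mul1r -p1 mulr_suml; apply: ler_sum => i _.
rewrite normrZ ger0_norm //.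
(* A nonzero [p i] means a positive weight, that is, [y i] within [eps] of [h (pt p)]. *)
have [->|pi] := eqVneq (p i) 0; first by rewrite !mul0r.
rewrite ler_wpM2l // leNgt; apply/negP => lt.
have : 0 < b i (pt p) by rewrite bE mulr_gt0 // lt_neqAle eq_sym pi p0.
by rewrite /b ltr0_norm; lra.
Qed.

(** * Domains with a quasi-convex metric *)

(** The centres lie in [A] itself, not only in its closure. The relation [Q] is abstract so as to
    serve for balls of the norm and of [d]. *)
Lemma compact_finite_net (X : ptopologicalType) (A : set X) (Q : X -> X -> Prop) :
    compact (closure A) ->
    (forall p, closure A p -> exists2 e, A e & \forall x \near p, Q e x) ->
  exists (k : nat) (y : 'I_k -> X),
    (forall i, A (y i)) /\ forall x, A x -> exists i, Q (y i) x.
Proof.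
rewrite compact_cover => cA AQ.
have [|p /AQ[e Ae Qe]|E EA Ecov] := cA X A (fun e => interior [set x | Q e x]).
- by move=> e _; exact: open_interior.
- by exists e.
pose E' := finmap.enum_fset E.
exists (size E'), (fun i => tnth (in_tuple E') i); split=> [i|x].
  by apply/set_mem/EA; apply: (mem_tnth i (in_tuple E')).
move=> /(@subset_closure _ A)/Ecov[e /= eE Qe].
have /tnthP[i e_i] : e \in in_tuple E' by [].
by exists i; rewrite -e_i; exact: (interior_subset Qe).
Qed.

Section QuasiConvexDomain.
Context (R : realType) (V : normedModType R) (D : set V) (d : V -> V -> R).
Hypotheses (D_open : open D) (D_strictly_convex : strictly_convex D).
Hypotheses (d_metric : metric_on D d) (d_axiom1' : axiom1' D d).
Hypothesis d_quasi_convex : quasi_convex_metric D d.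

Let d_ge0 x y : D x -> D y -> 0 <= d x y.
Proof. by case: d_metric => + _ _ _; exact. Qed.

Let d_sym x y : D x -> D y -> d x y = d y x.
Proof. by case: d_metric => _ _ + _; exact. Qed.

Let d_tri y x z : D x -> D y -> D z -> d x z <= d x y + d y z.
Proof. by case: d_metric => _ _ _; exact. Qed.

Let d_refl x : D x -> d x x = 0.
Proof. by case: d_metric => _ d0 _ _ Dx; apply/d0. Qed.

Lemma near_metric_ball p r : D p -> 0 < r -> \forall x \near p, D x /\ d p x < r.
Proof.
move=> Dp r0; have [top _] := d_axiom1'.
have [|O oO UE] := (top [set x | D x /\ d p x < r]).1.
  split=> [x []//|x [Dx pxr]]; exists (r - d p x); first by rewrite subr_gt0.
  move=> y Dy xy; split=> //; apply: le_lt_trans (d_tri Dp Dx Dy) _.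
  by rewrite addrC -ltrBrDr.
suff: nbhs p [set x | D x /\ d p x < r] by [].
rewrite UE; apply: open_nbhs_nbhs; split; first exact: openI.
by rewrite -UE /=; split=> //; rewrite d_refl.
Qed.

Lemma metric_ball_sub_nbhs p B : D p -> nbhs p B ->
  exists2 r, 0 < r & forall y, D y -> d p y < r -> B y.
Proof.
move=> Dp; rewrite nbhsE => -[W [oW Wp] WB]; have [top _] := d_axiom1'.
have [|_ /(_ p) [] // r r0 rP] := (top (W `&` D)).2; first by exists W.
by exists r => // y Dy py; apply: WB; have [] := rP _ Dy py.
Qed.

(** This turns the sequential axiom into a statement on neighbourhoods, usable along
    ultrafilters. *)
Lemma near_bdry_far xi w M : bdry D xi -> D w ->
  \forall x \near xi, D x -> M < d x w.
Proof.
move=> Dxi Dw; apply: contrapT => far.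
have /choice[x xP] n : exists x, [/\ `|xi - x| < n.+1%:R^-1, D x & d x w <= M].
  apply: contrapT => no; apply/far/nbhs_normP.
  exists n.+1%:R^-1; first by rewrite /= invr_gt0.
  move=> x /= xn Dx; rewrite ltNge; apply/negP => xM; apply: no.
  by exists x.
have xD n : D (x n) by have [] := xP n.
have x_xi : x n @[n --> \oo] --> xi.
  apply/cvgrPdist_lt => e e0; near=> n; have [xn _ _] := xP n.
  apply: lt_trans xn _; near: n; exact: (near_infty_natSinv_lt (PosNum e0)).
have [_ /(_ w Dw x xi xD Dxi x_xi)] := d_axiom1'.
move/cvgryPgt/(_ M) => far'.
have [n] := filter_ex far'; have [_ _ xM] := xP n.
by rewrite ltNge xM.
Unshelve. all: by end_near. Qed.


(** * Limits along filters, inside [D] and on its boundary *)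

Section Limits.
Context (J : Type) (F : set_system J) (FF : ProperFilter F).

Lemma limit_closure (x : J -> V) p :
  (forall j, D (x j)) -> x @ F --> p -> closure D p.
Proof.
move=> Dx; apply: (closed_cvg (closure D)); first exact: closed_closure.
by apply: nearW => j; apply: subset_closure.
Qed.

Lemma bounded_limit (x : J -> V) p w M : D w -> (forall j, D (x j)) ->
  x @ F --> p -> (\forall j \near F, d (x j) w <= M) -> D p.
Proof.
move=> Dw Dx xp xM; apply: contrapT => nDp.
have far := near_bdry_far M (conj (limit_closure Dx xp) nDp) Dw.
have [j [xMj farj]] := filter_ex (filterI xM (xp _ far)).
by move: (farj (Dx j)); rewrite ltNge xMj.
Qed.

Lemma unbounded_limit (x : J -> V) p w : D w -> (forall j, D (x j)) ->
  x @ F --> p -> (forall M, \forall j \near F, M < d (x j) w) -> bdry D p.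
Proof.
move=> Dw Dx xp xoo; split; first exact: limit_closure xp.
move=> Dp; have := xp _ (near_metric_ball Dp ltr01) => near_p.
have [j [xj [_ pxj]]] := filter_ex (filterI (xoo (1 + d p w)) near_p).
have := d_tri (Dx j) Dp Dw; rewrite (d_sym (Dx j) Dp); lra.
Qed.

(* By strict convexity the midpoints of x and y converge to a point of D,
   and by quasi-convexity they are no further from x than y is. *)
Lemma dist_to_separated_limits (x y : J -> V) (xi eta w : V) :
    D w -> (forall j, D (x j)) -> (forall j, D (y j)) ->
    x @ F --> xi -> y @ F --> eta -> xi <> eta ->
  exists K, \forall j \near F, d (x j) w <= d (x j) (y j) + K.
Proof.
move=> Dw Dx Dy xxi yeta neq.
pose mid (u v : V) := 2^-1 *: u + (1 - 2^-1) *: v.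
have Dc : D (mid xi eta).
  apply: D_strictly_convex => //; [exact: limit_closure xxi|exact: limit_closure yeta|lra].
have midc : mid (x j) (y j) @[j --> F] --> mid xi eta.
  by apply: cvgD; apply: cvgZl_tmp.
(* The [1] bounds the eventual distance from the midpoints to their limit. *)
exists (1 + d (mid xi eta) w).
have near_c : \forall j \near F, D (mid (x j) (y j)) /\
    d (mid xi eta) (mid (x j) (y j)) < 1.
  exact: midc _ (near_metric_ball Dc ltr01).
apply: filterS near_c => j [Dm dm].
have qc := d_quasi_convex (Dx j) (Dy j) (Dx j) (s := 2^-1) ltac:(lra).
rewrite d_refl // in qc.
have := d_tri (Dx j) Dm Dw; have := d_tri Dm Dc Dw.
rewrite (d_sym Dm Dc) (d_sym (Dx j) Dm).
have := d_ge0 (Dy j) (Dx j) => d0; rewrite max_r // (d_sym (Dy j) (Dx j)) in qc.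
rewrite -/(mid (x j) (y j)) in qc; lra.
Qed.

End Limits.

(** * Orbits of a compact nonexpansive map *)

Section NonexpansiveMap.
Variable g : V -> V.
Hypotheses (g_self : self_map D g) (g_nonexp : nonexpansive D d g).

Lemma nonexpansive_continuous p : D p -> {for p, continuous g}.
Proof.
move=> Dp B /(metric_ball_sub_nbhs (g_self Dp))[r r0 rB].
apply: filterS (near_metric_ball Dp r0) => x [Dx px].
by apply: rB; [exact: g_self|exact: le_lt_trans (g_nonexp Dp Dx) px].
Qed.

Lemma iter_self n : self_map D (iter n g).
Proof. by move=> x Dx; elim: n => //= n; apply: g_self. Qed.

Lemma iter_nonexp n : nonexpansive D d (iter n g).
Proof.
move=> x y Dx Dy; elim: n => //= n; apply: le_trans.
by apply: g_nonexp; apply: iter_self.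
Qed.

Hypothesis g_compact : compact_map D g.

(* The set of points that are eventually within a fixed distance of the orbit
   is convex and invariant, and Schauder's argument applies to it. *)
Lemma bounded_orbit_fixpoint z M : D z -> (forall n, d (iter n g z) z <= M) ->
  exists p, Fix D g p.
Proof.
move=> Dz zM.
pose A := [set x | D x /\ exists N, forall n, (N <= n)%N -> d (iter n g z) x <= M].
have Acvx x y (s : R) : A x -> A y -> 0 <= s <= 1 -> A (s *: x + (1 - s) *: y).
  move=> [Dx [Nx xM]] [Dy [Ny yM]] s01.
  have Ds : D (s *: x + (1 - s) *: y).
    have [->|nxy] := pselect (x = y).
      by rewrite -scalerDl addrC subrK scale1r.
    have [->|s0] := eqVneq s 0; first by rewrite scale0r add0r subr0 scale1r.
    have [->|s1] := eqVneq s 1; first by rewrite subrr scale0r addr0 scale1r.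
    apply: D_strictly_convex nxy _ _; try exact: subset_closure.
    by rewrite !lt_neqAle s1 eq_sym s0.
  split=> //; exists (maxn Nx Ny) => n; rewrite geq_max => /andP[nx ny].
  have Dn := iter_self n Dz.
  rewrite d_sym //; apply: le_trans (d_quasi_convex Dx Dy Dn s01) _.
  by rewrite ge_max !(d_sym _ Dn) // xM // yM.
have Ag x : A x -> A (g x).
  move=> [Dx [N xM]]; split; first exact: g_self.
  exists N.+1 => -[//|n] nN; apply: le_trans (xM n nN).
  by apply: g_nonexp => //; apply: iter_self.
have Az : A z by split=> //; exists 0%N.
have gAD : g @` A `<=` g @` D by move=> _ [x [Dx _] <-]; exists x.
have cgA : compact (closure (g @` A)).
  apply: subclosed_compact g_compact _; first exact: closed_closure.
  exact: closureS.
have approx n : exists x, A x /\ `|g x - x| <= n.+1%:R^-1.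
  have [p|k [y [yA ycov]]] :=
    @compact_finite_net V (g @` A) (fun e x => `|x - e| < n.+1%:R^-1) cgA.
    rewrite closureEcvg => -[G GF [Gp sG]].
    have near_p : \forall x \near p, `|p - x| < (n.+1%:R^-1 / 2 : R).
      by apply/nbhs_normP; exists (n.+1%:R^-1 / 2) => //; rewrite /= divr_gt0 ?invr_gt0.
    have [e [pe Ae]] := filter_ex (filterI (Gp _ near_p) (sG _ (fun x Ax => Ax))).
    exists e => //; apply: filterS near_p => x px.
    have -> : x - e = (p - e) - (p - x) by rewrite opprB [RHS]addrC addrA subrK.
    apply: le_lt_trans (ler_normB _ _) _; rewrite [ltRHS]splitr.
    exact: ltrD.
  have [||||x] := @schauder_approx R V A g n.+1%:R^-1 k y z Acvx.
  - by move=> x [Dx _]; apply: nonexpansive_continuous.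
  - by move=> i; have [x Ax <-] := yA i; apply: Ag.
  - by move=> x Ax; apply: ycov; exists x.
  - exact: Az.
  - by exists x.
have /choice[x xP] := approx.
have Dx n : D (x n) by have [[]] := xP n.
have [U [UU oU]] := ultraFilterLemma eventually_filter.
have [|p _ gxp] := @compact_ultra_cvg V _ nat U (g \o x) UU g_compact.
  by apply: nearW => n; apply: subset_closure; exists (x n).
have xp : x n @[n --> U] --> p.
  have -> : x = (fun n => (g \o x) n - (g (x n) - x n)).
    by apply/funext => n /=; rewrite opprB addrC subrK.
  suff x0 : (g (x n) - x n) @[n --> U] --> (0 : V).
    by rewrite -[p]subr0; apply: cvgB.
  apply/cvgr0Pnorm_lt => e e0.
  suff : \forall n \near \oo, `|g (x n) - x n| < e by apply: oU.
  near=> n; have [_ xn] := xP n; apply: le_lt_trans xn _.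
  near: n; exact: (near_infty_natSinv_lt (PosNum e0)).
(* Each [x n] is within [M] of some iterate of [z], itself within [M] of [z], so the limit cannot be
   on the boundary. *)
have Dp : D p.
  apply: (@bounded_limit _ U _ x p z (M + M)) => //.
  apply: nearW => n; have [[_ [N /(_ _ (leqnn N)) xN]] _] := xP n.
  have DN := iter_self N Dz; have := d_tri (Dx n) DN Dz.
  by rewrite (d_sym (Dx n) DN); have := zM N; lra.
exists p; split=> //.
have gp : g (x n) @[n --> U] --> g p.
  by apply: continuous_cvg => //; exact: nonexpansive_continuous.
exact: (@norm_cvg_unique _ _ (g \o x @ U) _ _ _ gp gxp).
Unshelve. all: by end_near. Qed.

(* Calka's argument: finitely many unit balls around orbit points cover the
   part of the orbit in the ball of radius [rho + 1], and each centre returns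
   to the ball of radius [rho] in boundedly many steps. *)
Lemma recurrent_orbit_bounded z rho : D z ->
    (forall N, exists2 n, (N <= n)%N & d (iter n g z) z < rho) ->
  exists M, forall n, d (iter n g z) z <= M.
Proof.
move=> Dz ret; have Dn n := iter_self n Dz.
pose E := [set x | (exists n, x = iter n g z) /\ d x z < rho + 1].
have cE : compact (closure E).
  rewrite -precompactE; apply: (@precompact_subset _ _ (g @` D `|` [set z])).
    move=> _ [[[|n] ->] _]; first by right.
    by left; exists (iter n g z).
  rewrite precompactE closureU; apply: compactU => //.
  have /closure_id <- : closed [set z].
    by apply: (@compact_closed V) => //; exact: compact_set1.
  exact: compact_set1.
have DE x : E x -> D x by case=> [[n ->] _].
have [p|k [e [eE ecov]]] := @compact_finite_net V E (fun e x => d e x < 1) cE.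
  rewrite closureEcvg => -[G GF [Gp sG]].
  (* The default [z] off [E] makes the family lie in [D] everywhere, as [bounded_limit] requires. *)
  have DG : forall x : V, D (if x \in E then x else z).
    by move=> x; case: ifP => // /set_mem /DE.
  have EG : \forall x \near G, E x by apply: sG.
  have Gp' : (if x \in E then x else z) @[x --> G] --> p.
    apply: cvg_trans Gp; apply: near_eq_cvg; apply: filterS EG => x Ex.
    by rewrite mem_set.
  have Dp : D p.
    apply: (@bounded_limit V G _ (fun x => if x \in E then x else z) p z (rho + 1)) => //.
    by apply: filterS EG => x Ex; rewrite mem_set //; case: Ex => _ /ltW.
  have half_gt0 : 0 < 2^-1 :> R by rewrite invr_gt0.
  have near_p := near_metric_ball Dp half_gt0.
  have [x [[Dx px] Ex]] := filter_ex (filterI (Gp _ near_p) (sG _ (fun x Ax => Ax))).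
  exists x => //; apply: filterS near_p => y [Dy py].
  by have := d_tri Dx Dp Dy; rewrite (d_sym Dx Dp); lra.
have /choice[r rP] : forall i, exists r, (0 < r)%N /\ d (iter r g (e i)) z < rho.
  move=> i; have [[n en] _] := eE i; have [m nm mrho] := ret n.+1.
  exists (m - n)%N; split; first by rewrite subn_gt0.
  by rewrite en -iterD subnK // ltnW.
pose N := (\max_i r i)%N.
(* When the last visit is [N] steps old, the centre [e i] near it returns within [rho] after
   [r i <= N] steps, and the orbit follows within distance 1. *)
have visit n : exists m, [/\ (m <= n)%N, (n <= m + N)%N & E (iter m g z)].
  elim: n => [|n [m [mn nm Em]]].
    exists 0%N; split=> //; split; first by exists 0%N.
    have [n _ nrho] := ret 0%N; rewrite /= d_refl //.
    by have := d_ge0 (Dn n) Dz; lra.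
  have [le|lt] := leqP n.+1 (m + N); first by exists m; split=> //; exact: leqW.
  have [i ei] := ecov _ Em; have [r0 ri] := rP i.
  have riN : (r i <= N)%N by apply: leq_bigmax.
  exists (r i + m)%N; split; [by lia|by lia|].
  split; first by exists (r i + m)%N.
  rewrite iterD; have De := DE _ (eE i).
  have := d_tri (iter_self (r i) (Dn m)) (iter_self (r i) De) Dz.
  have := iter_nonexp (r i) (Dn m) De; rewrite (d_sym (Dn m) De); lra.
(* The last visit to [E] costs [rho + 1]; the sum bounds the drift over the at most [N] steps since
   then. *)
exists (rho + 1 + \sum_(j < N.+1) d (iter j g z) z) => n.
have [m [mn nm [_ Em]]] := visit n.
have jN : (n - m < N.+1)%N by rewrite ltnS leq_subLR.
have -> : n = ((n - m) + m)%N by rewrite subnK.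
rewrite iterD (bigD1 (Ordinal jN)) //=.
have := d_tri (iter_self (n - m) (Dn m)) (Dn (n - m)%N) Dz.
have := iter_nonexp (n - m) (Dn m) Dz.
have : 0 <= \sum_(j < N.+1 | j != Ordinal jN) d (iter j g z) z.
  by apply: sumr_ge0 => j _; apply: d_ge0.
lra.
Qed.

Hypothesis g_fixfree : Fix D g = set0.

Lemma orbit_escapes z M : D z -> \forall n \near \oo, M < d (iter n g z) z.
Proof.
move=> Dz; apply: contrapT => often.
have [|B zB] := @recurrent_orbit_bounded z (M + 1) Dz.
  move=> N; apply: contrapT => no; apply: often; exists N => // n /= Nn.
  rewrite ltNge; apply/negP => le; apply: no; exists n => //; lra.
have [p] := bounded_orbit_fixpoint Dz zB.
by rewrite g_fixfree.
Qed.

(** The first time at which the distance exceeds a bound [M] for the first [N.+1] distances is a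
    record. *)
Lemma orbit_record_times z N : D z ->
  exists2 n, (N <= n)%N &
    forall m, (m <= n)%N -> d (iter m g z) z <= d (iter n g z) z.
Proof.
move=> Dz; have Dn n := iter_self n Dz.
pose M := \sum_(j < N.+1) d (iter j g z) z.
have MP m : (m <= N)%N -> d (iter m g z) z <= M.
  rewrite -ltnS => mN; rewrite /M (bigD1 (Ordinal mN)) //= lerDl.
  by apply: sumr_ge0 => j _; apply: d_ge0.
have exM : exists n, M < d (iter n g z) z.
  by have [n] := filter_ex (orbit_escapes M Dz); exists n.
have [n nM nmin] := ex_minnP exM.
exists n.
  by rewrite leqNgt; apply/negP => /ltnW/MP; rewrite leNgt nM.
move=> m; rewrite leq_eqVlt => /predU1P[->//|mn].
apply: le_trans (ltW nM); rewrite leNgt; apply/negP => /nmin.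
by rewrite leqNgt mn.
Qed.

Variable kappa : R.
Hypothesis d_quasi_geodesic : quasi_geodesic1 D d kappa.

(* [p] and [q] lie on the quasi-geodesic at times at most 1 apart, [q] being
   taken close to the supremum of the times spent in the ball; this is why
   the quasi-geodesic need not be continuous. *)
Lemma quasi_geodesic_crossing x y xi (e : R) : D x -> D y ->
    `|g x - xi| < e -> e <= `|g y - xi| ->
  exists p q, [/\ D p, D q, e <= `|g p - xi|, `|g q - xi| < e
    & d (g x) (g p) + d (g q) (g y) <= d x y + 1 + 3 * kappa].
Proof.
move=> Dx Dy xe ye.
have [a [b [gam [ab gama gamb Dgam qg]]]] := d_quasi_geodesic Dx Dy.
pose S := [set t | t \in `[a, b] /\ `|g (gam t) - xi| < e].
have aI : a \in `[a, b] by rewrite in_itv /= lexx.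
have bI : b \in `[a, b] by rewrite in_itv /= lexx andbT.
have Sa : S a by split; rewrite // gama.
have hS : has_sup S.
  split; first by exists a.
  by exists b => t [+ _]; rewrite in_itv /= => /andP[].
have [t1 St1 t1sup] := sup_adherent (ltr01 : 0 < 1 :> R) hS.
have [t1I t1e] := St1; have := t1I; rewrite in_itv /= => /andP[at1 t1b].
(* [t1 + 1] is beyond the supremum of [S]; if it is also beyond [b], the endpoint [b] serves. *)
have [t2 [t2I t12 t2e]] : exists t2, [/\ t2 \in `[a, b], t1 <= t2 <= t1 + 1
    & e <= `|g (gam t2) - xi|].
  have [le|lt] := leP (t1 + 1) b.
    have I : t1 + 1 \in `[a, b] by rewrite in_itv /=; lra.
    exists (t1 + 1); split=> //; first lra.
    rewrite leNgt; apply/negP => lt.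
    have := sup_ubound hS.2 (conj I lt : S (t1 + 1)); lra.
  by exists b; split=> //; rewrite ?gamb //; lra.
exists (gam t2), (gam t1); split=> //; try exact: Dgam.
have := t2I; rewrite in_itv /= => /andP[at2 t2b].
have /andP[_] := qg _ _ aI t2I; rewrite gama distrC ger0_norm ?subr_ge0 // => q1.
have /andP[_] := qg _ _ t1I bI; rewrite gamb distrC ger0_norm ?subr_ge0 // => q2.
have /andP[+ _] := qg _ _ aI bI; rewrite gama gamb distrC ger0_norm ?subr_ge0 // => q3.
(* Each of [q1], [q2], [q3] contributes one [kappa], and [t2 - t1] contributes at most 1. *)
have := g_nonexp Dx (Dgam _ t2I); have := g_nonexp (Dgam _ t1I) Dy; lra.
Qed.

(* Take xi to be a limit along record times and suppose that eta is another
   limit point. Applying g to quasi-geodesics between the two subsequences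
   gives points in a compact set, which compensates for the lack of local
   compactness, and shows d(z_n, z) + d(z_k, z) <= d(z_n, z_k) + const; as n
   is a record time larger than k, d(z_k, z) would be bounded. *)
Lemma orbit_cvg_bdry z : D z -> exists2 xi, bdry D xi & iter n g z @[n --> \oo] --> xi.
Proof.
move=> Dz; have Dn n := iter_self n Dz.
pose K := closure (g @` D).
have KS n : K (iter n.+1 g z) by apply: subset_closure; exists (iter n g z).
have /choice[r rP] : forall N, exists n, (N < n)%N /\
    forall m, (m <= n)%N -> d (iter m g z) z <= d (iter n g z) z.
  by move=> N; have [n Nn nP] := orbit_record_times N.+1 Dz; exists n.
have [U [UU oU]] := ultraFilterLemma eventually_filter.
have [|xi _ rxi] :=
  @compact_ultra_cvg V K nat U (fun j => iter (r j) g z) UU g_compact.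
  by apply: nearW => j; have [] := rP j; case: (r j) => // n _ _; exact: KS.
have escape (s : nat -> nat) : (forall j, (j <= s j)%N) -> forall M,
    \forall j \near \oo, M < d (iter (s j) g z) z.
  move=> js M; have [N _ NP] := orbit_escapes M Dz.
  by exists N => // j /= Nj; apply: NP => /=; exact: leq_trans (js j).
have xi_bdry : bdry D xi.
  apply: (@unbounded_limit _ U _ (fun j => iter (r j) g z) xi z) => // M.
  by apply/oU/escape => j; have [/ltnW] := rP j.
exists xi => //; apply: contrapT => ncvg.
have [e e0 often] : exists2 e, 0 < e & forall N, exists2 n, (N <= n)%N &
    e <= `|iter n g z - xi|.
  apply: contrapT => no; apply: ncvg; apply/cvgrPdist_lt => e e0.
  apply: contrapT => ne; apply: no; exists e => // N; apply: contrapT => noN.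
  apply: ne; exists N => // n /= Nn; rewrite ltNge; apply/negP => le; apply: noN.
  by exists n; rewrite // distrC.
have /choice[k kP] : forall j, exists k, (j < k)%N /\ e <= `|iter k g z - xi|.
  by move=> j; have [k jk ke] := often j.+1; exists k.
have /choice[n nP] : forall j, exists n, [/\ (k j < n)%N,
    `|iter n g z - xi| < Num.min (e / 2) j.+1%:R^-1 &
    forall m, (m <= n)%N -> d (iter m g z) z <= d (iter n g z) z].
  move=> j.
  have m0 : 0 < Num.min (e / 2) j.+1%:R^-1 by rewrite lt_min divr_gt0 ?invr_gt0 /=.
  have U1 : \forall i \near U, `|iter (r i) g z - xi| < Num.min (e / 2) j.+1%:R^-1.
    by have /cvgrPdist_lt/(_ _ m0) := rxi; apply: filterS => i; rewrite distrC.
  have U2 : \forall i \near U, (k j <= i)%N by apply: oU; exists (k j).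
  have [i [i1 i2]] := filter_ex (filterI U1 U2).
  have [ri rmax] := rP i.
  by exists (r i); split=> //; exact: leq_ltn_trans ri.
have nxi : iter (n j) g z @[j --> \oo] --> xi.
  apply/cvgrPdist_lt => e' e'0; near=> j; have [_ + _] := nP j.
  rewrite distrC lt_min => /andP[_ nj]; apply: lt_trans nj _.
  near: j; exact: (near_infty_natSinv_lt (PosNum e'0)).
(* The quasi-geodesic joins the predecessors of the two iterates, and its image under [g] is cut at
   radius [e / 2], strictly between the limits of the two subsequences. *)
have /choice[pq pqP] : forall j, exists pq : V * V, [/\ D pq.1, D pq.2,
    e / 2 <= `|g pq.1 - xi|, `|g pq.2 - xi| < e / 2
    & d (iter (n j) g z) (g pq.1) + d (g pq.2) (iter (k j) g z)
      <= d (iter (n j) g z) z + 1 + 3 * kappa].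
  move=> j; have [kn ne nmax] := nP j; have [jk ke] := kP j.
  case: (n j) kn ne nmax => // n' kn ne nmax.
  case: (k j) jk ke kn => // k' _ ke kn.
  have [||p [q [Dp Dq pe qe le]]] :=
    @quasi_geodesic_crossing _ _ xi (e / 2) (Dn n') (Dn k').
  - by move: ne; rewrite lt_min => /andP[].
  - by apply: le_trans ke; lra.
  exists (p, q); split=> //=; apply: le_trans le _; rewrite !lerD2r.
  (* Removing [k'] common iterations leaves the distance from the iterate [n' - k'] to [z], which
     the record at [n'.+1] bounds. *)
  rewrite -(subnK (_ : k' <= n')%N); last by rewrite ltnW.
  rewrite addnC iterD; apply: le_trans (iter_nonexp k' (Dn (n' - k')%N) Dz) _.
  rewrite -(iterD) -iterS addnC subnK 1?ltnW //.
  by apply: nmax; rewrite (leq_trans (leq_subr _ _)).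
have [W [WU oW]] := ultraFilterLemma eventually_filter.
have Dg1 j : D (g (pq j).1) by apply: g_self; have [] := pqP j.
have Dg2 j : D (g (pq j).2) by apply: g_self; have [] := pqP j.
have [|eta _ keta] :=
  @compact_ultra_cvg V K nat W (fun j => iter (k j) g z) WU g_compact.
  by apply: nearW => j; have [] := kP j; case: (k j) => // m _ _; exact: KS.
have [|mu _ pmu] :=
  @compact_ultra_cvg V K nat W (fun j => g (pq j).1) WU g_compact.
  by apply: nearW => j; apply: subset_closure; exists (pq j).1 => //; have [] := pqP j.
have [|nu _ qnu] :=
  @compact_ultra_cvg V K nat W (fun j => g (pq j).2) WU g_compact.
  by apply: nearW => j; apply: subset_closure; exists (pq j).2 => //; have [] := pqP j.
have normW (x : nat -> V) l : x @ W --> l -> `|x j - xi| @[j --> W] --> `|l - xi|.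
  by move=> xl; apply: cvg_norm; apply: cvgB => //; exact: cvg_cst.
have xi_mu : xi <> mu.
  move=> E; have := @ler_cvg_to _ W _ _ (fun=> e / 2) _ _ _ (cvg_cst _) (normW _ _ pmu).
  rewrite -E subrr normr0 leNgt divr_gt0 //= => H; apply: notF; apply: H.
  by apply: nearW => j; have [] := pqP j.
have eta_nu : eta <> nu.
  move=> E.
  have le1 : e <= `|eta - xi|.
    apply: (@ler_cvg_to _ W _ _ (fun=> e) _ _ _ (cvg_cst _) (normW _ _ keta)).
    by apply: nearW => j; have [] := kP j.
  have le2 : `|nu - xi| <= e / 2.
    apply: (@ler_cvg_to _ W _ _ _ (fun=> e / 2) _ _ (normW _ _ qnu) (cvg_cst _)).
    by apply: nearW => j; have [_ _ _ /ltW] := pqP j.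
  by move: le1; rewrite E; lra.
have nxiW : iter (n j) g z @[j --> W] --> xi by apply: cvg_trans nxi => B; exact: oW.
have [K1 near1] :=
  dist_to_separated_limits _ Dz (fun j => Dn (n j)) Dg1 nxiW pmu xi_mu.
have [K2 near2] :=
  dist_to_separated_limits _ Dz (fun j => Dn (k j)) Dg2 keta qnu eta_nu.
(* Adding [near1] and [near2] to the crossing inequality cancels the distance of the record iterate
   to [z] and leaves this bound for the iterate [k j]. *)
have far := oW _ (escape k (fun j => ltnW (kP j).1) (1 + 3 * kappa + K1 + K2)).
have [j [[j1 j2] j3]] := filter_ex (filterI (filterI near1 near2) far).
have [_ _ _ _ le] := pqP j.
by move: j2 j3; rewrite (d_sym (Dn (k j)) (Dg2 j)) /=; lra.
Unshelve. all: by end_near. Qed.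

End NonexpansiveMap.

End QuasiConvexDomain.

(** * Semigroups *)

Lemma semigroup_iter (R : realType) (V : normedModType R) (D : set V)
    (f : R -> V -> V) (t : R) (n : nat) (x : V) :
  continuous_semigroup D f -> 0 <= t -> D x -> f (n%:R * t) x = iter n (f t) x.
Proof.
case=> _ fD f0 _ t0 Dx; elim: n => [|n IH]; first by rewrite mul0r f0.
by rewrite -natr1 mulrDl mul1r fD ?mulr_ge0 // IH.
Qed.

(** Continuity at time 0 gives [del] such that the orbit moves [z] by at most 1 up to time [del]; by
    nonexpansiveness [n] such steps move it by at most [n]. *)
Lemma semigroup_orbit_bounded (R : realType) (V : normedModType R) (D : set V)
    (d : V -> V -> R) (f : R -> V -> V) (z : V) (T : R) :
    open D -> metric_on D d -> axiom1' D d -> continuous_semigroup D f ->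
    (forall t, 0 <= t -> nonexpansive D d (f t)) -> D z ->
  exists M, forall s, 0 <= s <= T -> d (f s z) z <= M.
Proof.
move=> Do dm ax [fS fD f0 fc] fn Dz.
have [_ d0 d_sym d_tri] := dm.
have dzz : d z z = 0 by apply/d0.
have [del del0 delP] : exists2 del, 0 < del & forall h, 0 <= h <= del -> d (f h z) z <= 1.
  have : \forall h \near (0 : R), 0 < h -> D (f h z) /\ d z (f h z) < 1.
    exact: fc z Dz _ (near_metric_ball Do dm ax Dz ltr01).
  case/nbhs_normP => e /= e0 eP.
  exists (e / 2) => [|h /andP[h0 he]]; first by rewrite divr_gt0.
  have [->|hn0] := eqVneq h 0; first by rewrite f0 // dzz.
  have hpos : 0 < h by rewrite lt_neqAle eq_sym hn0.
  have [|//|Df] := eP h; first by rewrite /= sub0r normrN gtr0_norm //; lra.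
  by rewrite d_sym // => /ltW.
have step (n : nat) s : 0 <= s <= n%:R * del -> d (f s z) z <= n%:R.
  elim: n s => [|n IH] s; first by rewrite mul0r -eq_le => /eqP<-; rewrite f0 // dzz.
  move=> /andP[s0 sn]; pose h := Num.min s del.
  have h0 : 0 <= h <= del by rewrite /h le_min s0 (ltW del0) ge_min lexx orbT.
  have s'0 : 0 <= s - h <= n%:R * del.
    rewrite /h; move: sn; rewrite -natr1 mulrDl mul1r => sn.
    by case: (leP s del) => sd; rewrite ?subrr ?lexx ?mulr_ge0 ?(ltW del0) //=; lra.
  have /andP[hge _] := h0; have /andP[s'ge _] := s'0.
  have -> : s = h + (s - h) by rewrite addrC subrK.
  have Dh := fS _ hge _ Dz.
  rewrite fD // -natr1.
  apply: le_trans (d_tri _ (f (s - h) z) _ _ _ _) _ => //; try exact: fS.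
  rewrite addrC lerD // ?IH //.
  by apply: le_trans (fn _ s'ge _ _ Dh Dz) _; exact: delP.
have [n nT] : exists n : nat, T <= n%:R * del.
  exists (Num.trunc `|T / del|).+1; rewrite -ler_pdivrMr //.
  have /andP[_ /ltW] := truncn_itv (normr_ge0 (T / del)); exact/le_trans/ler_norm.
exists n%:R => s /andP[s0 sT]; apply: step; rewrite s0; exact: le_trans nT.
Qed.

Unset Implicit Arguments.

(* [sup] is the real supremum; the set is bounded for every [t >= 0] since
   [D] is, and [sup set0 = 0] covers the case where [C] is empty. *)
Theorem theorem3p9 (R : realType) (V : completeNormedModType R)
    (D : set V) (d : V -> V -> R) (kappa : R) (f : R -> V -> V)
    (D_domain : domain D) (D_bounded : bounded_set D)
    (D_strictly_convex : strictly_convex D)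
    (d_metric : metric_on D d)
    (kappa_ge0 : 0 <= kappa) (d_quasi_geodesic : quasi_geodesic1 D d kappa)
    (d_axiom1' : axiom1' D d)
    (d_quasi_convex : quasi_convex_metric D d)
    (f_semigroup : continuous_semigroup D f)
    (f_nonexpansive : forall t, 0 <= t -> nonexpansive D d (f t))
    (f_compact_nofix : exists t0 : R,
      [/\ 0 < t0, compact_map D (f t0) & Fix D (f t0) = set0]) :
  exists2 xi : V, bdry D xi &
    forall C : set V, C `<=` D -> metric_bounded d C ->
      sup [set `|f t x - xi| | x in C] @[t --> +oo] --> (0 : R).
Proof.
have [t0 [t0_gt0 g_compact g_fixfree]] := f_compact_nofix.
have [[z Dz] D_open _] := D_domain.
have t0_ge0 := ltW t0_gt0.
have [f_self f_add _ _] := f_semigroup.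
have [_ _ d_sym d_tri] := d_metric.
have g_self := f_self _ t0_ge0; have g_nonexp := f_nonexpansive _ t0_ge0.
have [xi xi_bdry zxi] := orbit_cvg_bdry D_open D_strictly_convex d_metric
  d_axiom1' d_quasi_convex g_self g_nonexp g_compact g_fixfree d_quasi_geodesic Dz.
exists xi => // C CD [M CM].
have Dn n : D (iter n (f t0) z) by apply: iter_self.
suff unif e : 0 < e -> \forall t \near +oo, forall x, C x -> `|f t x - xi| <= e.
  apply/cvgrPdist_le => e e0; apply: filterS (unif e e0) => t tC.
  have [->|/set0P[x Cx]] := eqVneq C set0.
    by rewrite image_set0 sup0 subrr normr0 ltW.
  have ubC : ubound [set `|f t x - xi| | x in C] e by move=> _ [y Cy <-]; exact: tC.
  rewrite sub0r normrN ger0_norm; first by apply: ge_sup => //; exists `|f t x - xi|, x.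
  by apply: le_trans (normr_ge0 (f t x - xi)) _; apply: ub_le_sup; [exists e | exists x].
move=> e0; apply: contrapT => not_unif.
have /choice[tx txP] : forall j : nat, exists tx : R * V,
    [/\ j.+1%:R * t0 <= tx.1, C tx.2 & e < `|f tx.1 tx.2 - xi|].
  move=> j; apply: contrapT => no; apply: not_unif.
  exists (j.+1%:R * t0); split; first exact: num_real.
  move=> t jt x Cx; rewrite leNgt; apply/negP => lt; apply: no.
  by exists (t, x); split=> //=; exact: ltW.
(* Time is split into whole periods and a remainder. At least one period elapses, which puts [a j]
   in the image of [f t0]. *)
have /choice[ns nsP] : forall j, exists ns : nat * R,
    [/\ (j < ns.1)%N, 0 <= ns.2 <= t0 & (tx j).1 = ns.2 + ns.1%:R * t0].
  move=> j; have [jt _ _] := txP j.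
  have t_ge0 : 0 <= (tx j).1 / t0.
    by rewrite divr_ge0 // (le_trans _ jt) // mulr_ge0.
  have /andP[le lt] := truncn_itv t_ge0.
  set n := Num.trunc _ in le lt.
  exists (n, (tx j).1 - n%:R * t0); split=> /=; last by rewrite subrK.
    rewrite -ltnS -(ltr_nat R); apply: le_lt_trans lt.
    by rewrite ler_pdivlMr.
  move: le lt; rewrite ler_pdivlMr // ltr_pdivrMr // -natr1 mulrDl mul1r; lra.
have [B zB] := @semigroup_orbit_bounded R V D d f z t0 D_open d_metric d_axiom1'
  f_semigroup f_nonexpansive Dz.
pose a j := f (tx j).1 (tx j).2.
have Dx j : D (tx j).2 by have [_ /CD] := txP j.
have aE j : a j = iter (ns j).1 (f t0) (f (ns j).2 (tx j).2).
  rewrite /a; have [_ /andP[s0 _] ->] := nsP j.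
  rewrite f_add ?mulr_ge0 // (semigroup_iter _ f_semigroup) //.
  exact: f_self.
have Da j : D (a j).
  by rewrite aE; apply: iter_self => //; apply: f_self => //; have [_ /andP[]] := nsP j.
(* [M] compares points of [C], [(tx 0%N).2] is a reference point in [C], and [B] bounds the motion
   of [z] during the remainder. *)
have az j : d (a j) (iter (ns j).1 (f t0) z) <= M + d (tx 0%N).2 z + B.
  have [_ s0t _] := nsP j; have /andP[s0 _] := s0t.
  have Ds u : D u -> D (f (ns j).2 u) by exact: f_self.
  rewrite aE; apply: le_trans (iter_nonexp g_self g_nonexp _ (Ds _ (Dx j)) Dz) _.
  have := zB _ s0t; have := f_nonexpansive _ s0 _ _ (Dx j) Dz.
  have := d_tri _ _ _ (Ds _ (Dx j)) (Ds _ Dz) Dz.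
  have := d_tri _ _ _ (Dx j) (Dx 0%N) Dz.
  have [_ C0 _] := txP 0%N; have [_ Cj _] := txP j.
  have := CM _ _ Cj C0; lra.
have [U [UU oU]] := ultraFilterLemma eventually_filter.
have [|eta _ aeta] := @compact_ultra_cvg V _ nat U a UU g_compact.
  apply: nearW => j; apply: subset_closure; rewrite aE.
  have [] := nsP j; case: (ns j).1 => // n _ /andP[s0 _] _.
  exists (iter n (f t0) (f (ns j).2 (tx j).2)) => //.
  by apply: iter_self => //; exact: f_self.
have escape K : \forall j \near \oo, K < d (iter (ns j).1 (f t0) z) z.
  have [N _ NP] := orbit_escapes D_open D_strictly_convex d_metric d_axiom1'
    d_quasi_convex g_self g_nonexp g_compact g_fixfree K Dz.
  exists N => // j /= Nj; apply: NP => /=.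
  by have [jn _ _] := nsP j; rewrite ltnW // (leq_ltn_trans Nj).
have nxi : iter (ns j).1 (f t0) z @[j --> U] --> xi.
  move=> W /zxi[N _ NP]; apply: oU; exists N => // j /= Nj; apply: NP => /=.
  by have [jn _ _] := nsP j; rewrite ltnW // (leq_ltn_trans Nj).
have xi_eta : xi <> eta.
  move=> E; have ax : `|a j - xi| @[j --> U] --> `|eta - xi|.
    by apply: cvg_norm; apply: cvgB => //; exact: cvg_cst.
  have : e <= `|eta - xi|.
    apply: (@ler_cvg_to _ U _ _ (fun=> e) _ _ _ (cvg_cst _) ax).
    by apply: nearW => j; have [_ _ /ltW] := txP j.
  by rewrite E subrr normr0 leNgt e0.
(* With distinct limits, [az] would bound the distances of the iterates to [z] along [U], against
   [escape]. *)
have [K near_K] := dist_to_separated_limits D_open D_strictly_convex d_metric d_axiom1'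
  d_quasi_convex _ Dz (fun j => Dn (ns j).1) Da nxi aeta xi_eta.
have far := oU _ (escape (M + d (tx 0%N).2 z + B + K)).
have [j [j1 j2]] := filter_ex (filterI near_K far).
have := az j; rewrite (d_sym _ _ (Da j) (Dn _)); move: j1 j2 => /=; lra.
Qed.
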